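(* Let $n\ge0$ and let $\sigma,\tau\in\mathrm{Typ}(n)$ be types of $n$. The coefficient of $E_\tau$ in the expansion of $E^+_\sigma$ in the basis $\{E_\rho:\rho\in\mathrm{Typ}(n)\}$ is $$\sum_{T\in \mathcal{PT}_E^{\mathrm{doub}}(\sigma, \tau)} (-1)^{\ell_1(T)}.$$
   Context: A type of $n$ is a sequence $\tau=(\tau|^1,\tau|^2,\dots)$ of (possibly empty) integer partitions with $\sum_{i\ge1} i\,|\tau|^i|=n$, where $|\tau|^i|$ is the size of the partition $\tau|^i$; $\mathrm{Typ}(n)$ is the set of types of $n$. Each part $d$ of $\tau|^r$ gives a block $d^r$ of $\tau$ (degree $d$, multiplicity $r$; not exponentiation); a type is thus a multiset of blocks. Let $x_{i,j}$ ($i,j\ge 1$) be indeterminates with $\deg x_{i,j}=i$; all series have rational coefficients. A monomial is square-free if every exponent is at most $1$. $E^+_d$ is the sum of all square-free monomials of degree $d$; $E_d$ is the sum over square-free monomials $f$ of degree $d$ of $(-1)^{m(f)}f$, where $m(f)$ is the number of indeterminates in $f$. For $F\in\{E,E^+\}$, $F_{d^r}$ is obtained from $F_d$ by replacing each $x_{i,j}$ by $x_{i,j}^r$, and $F_\tau=\prod F_{d^r}$ over all blocks $d^r$ of $\tau$ (counted with repetition; empty product $=1$). It is known that $\{F_\tau\}_{\tau\in\mathrm{Typ}(n)}$ is, for each such $F$, a $\mathbb{Q}$-basis of the space $\mathrm{PSym}(n)$ of polysymmetric functions of degree $n$ (power series homogeneous of degree $n$ that are symmetric separately in each variable set $\{x_{i,j}\}_{j\ge1}$).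 The diagram of a partition $\lambda$ has left-justified rows of $\lambda_1,\lambda_2,\dots$ cells; the tensor diagram of $\sigma$ is the sequence of diagrams of $\sigma|^1,\sigma|^2,\dots$, the $i$th one being called the $i$th tensor factor. A brick is a nonempty set of consecutive cells in one row; its length is its number of cells. A doublebrick is a brick of even length marked with a $+$ sign (and is distinguished from unmarked bricks, simply called bricks). A double polybrick tabloid of shape $\sigma$ and content $\tau$ is a decomposition of the tensor diagram of $\sigma$ into disjoint bricks and doublebricks such that, in each row, all doublebricks appear to the right of all bricks, and such that $\tau$ is the multiset of blocks obtained by taking a block $a^m$ for each brick of length $a$ in the $m$th tensor factor and a block $b^{2m}$ for each doublebrick of length $2b$ in the $m$th tensor factor. $\mathcal{PT}_E^{\mathrm{doub}}(\sigma,\tau)$ is the set of double polybrick tabloids of shape $\sigma$ and content $\tau$ with at most one doublebrick in each row. For such $T$, $\ell_1(T)$ is the number of (unmarked) bricks in $T$. *)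

(* Defs.v *)
(* [boolp] provides the extensionality of functions: two power series are
   equal when they have the same coefficients. *)
From HB Require Import structures.
From mathcomp Require Import all_boot all_order all_algebra.
From mathcomp Require Import finmap multiset boolp.

Set Implicit Arguments.
Unset Strict Implicit.
Unset Printing Implicit Defensive.

Import Order.TTheory GRing.Theory Num.Theory.

Local Open Scope mset_scope.
Local Open Scope ring_scope.

(* The variable x_{i,j} (i, j >= 1) is the pair (i - 1, j - 1); a monomial is
   the finite multiset of its variables, so [m v] is the exponent of [v], the
   product of monomials is [`+`] and divisibility is [`<=`]. *)
Notation monom := ({mset nat * nat}).

Section Monomials.
Implicit Types a b c m : monom.

Definition mdegree m : nat := (\sum_(v <- finsupp m) m v * v.1.+1)%N.

Definition square_free m : bool := [forall v : finsupp m, (m (val v) <= 1)%N].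

Definition nvars m : nat := #|` finsupp m|.

Definition mpow (r : nat) m : monom := [fsfun v in finsupp m => (r * m v)%N | 0%N].

Lemma mpowE r m v : mpow r m v = (r * m v)%N.
Proof.
rewrite fsfunE; case: ifPn => // vNm.
by rewrite fsfun_dflt ?muln0.
Qed.

Definition divisors m : {fset monom} :=
  [fset seq_mset (mask (tval t) m) | t : (size m).-tuple bool]%fset.

Lemma mem_divisors a m : (a \in divisors m) = (a `<=` m)%mset.
Proof.
apply/imfsetP/idP => [[t _ ->]|/msubsetP le_am].
  apply/msubsetP => v; rewrite mset_seqE -[m v]count_mem_mset.
  by apply: (proj2 (count_subseqP _ _)); exists (mask t m); rewrite ?mask_subseq.
have [|s /subseqP[t szt ->] ps] := proj1 (count_subseqP a m) _.
  by move=> v; rewrite !count_mem_mset.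
exists (Tuple (introT eqP szt)) => //=; apply/msetP => v.
by rewrite mset_seqE -count_mem_mset; apply/permP.
Qed.

End Monomials.

Definition series : Type := monom -> rat.

HB.instance Definition _ := Choice.copy series (monom -> rat).

Section SeriesRing.
Implicit Types (f g h : series) (m : monom) (k : rat).

Definition sadd f g : series := fun m => f m + g m.
Definition sopp f : series := fun m => - f m.
Definition szero : series := fun=> 0.
Definition sscale k f : series := fun m => k * f m.
Definition sone : series := fun m => (m == mset0)%:R.
Definition smul f g : series :=
  fun m => \sum_(a <- divisors m) f a * g (m `\` a)%mset.

Fact saddA : associative sadd.
Proof. by move=> f g h; apply/funext => m; rewrite /sadd addrA. Qed.
Fact saddC : commutative sadd.
Proof. by move=> f g; apply/funext => m; rewrite /sadd addrC. Qed.
Fact sadd0 : left_id szero sadd.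
Proof. by move=> f; apply/funext => m; rewrite /sadd add0r. Qed.
Fact saddN : left_inverse szero sopp sadd.
Proof. by move=> f; apply/funext => m; rewrite /sadd addNr. Qed.

HB.instance Definition _ :=
  GRing.isZmodule.Build series saddA saddC sadd0 saddN.

Fact smulC : commutative smul.
Proof.
move=> f g; apply/funext => m; rewrite /smul.
pose s := [seq (m `\` a)%mset | a <- divisors m].
have mK a : a \in divisors m -> (m `\` (m `\` a))%mset = a.
  by rewrite mem_divisors => /msetBBK.
have sE : perm_eq (divisors m) s.
  apply: uniq_perm; first exact: fset_uniq.
    rewrite map_inj_in_uniq ?fset_uniq // => a b am bm eqab.
    by rewrite -(mK a am) eqab mK.
  have divB a : (m `\` a)%mset \in divisors m.
    by rewrite mem_divisors; apply/msubsetP => v; rewrite msetE2 leq_subr.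
  move=> a; apply/idP/mapP => [am|[b _ ->]]; last exact: divB.
  by exists (m `\` a)%mset; rewrite ?divB ?mK.
rewrite (perm_big _ sE) big_map; apply: eq_big_seq => a am.
by rewrite mK // mulrC.
Qed.

Fact smul1 : left_id sone smul.
Proof.
move=> f; apply/funext => m; rewrite /smul /sone.
rewrite (big_rem mset0) ?mem_divisors ?msub0set //= eqxx mul1r msetB0.
rewrite big_seq big1 ?addr0 // => a.
by rewrite mem_rem_uniq ?fset_uniq // inE => /andP[/negPf-> _]; rewrite mul0r.
Qed.

Fact smulDl : left_distributive smul +%R.
Proof.
move=> f g h; apply/funext => m.
rewrite -[RHS]/(smul f h m + smul g h m) -big_split /=.
by apply: eq_bigr => a _; rewrite -mulrDl.
Qed.

Fact smulA : associative smul.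
Proof.
move=> f g h; apply/funext => m; rewrite /smul.
transitivity (\sum_(a <- divisors m) \sum_(c <- divisors m | (a `<=` c)%mset)
    f a * g (c `\` a)%mset * h (m `\` c)%mset).
  apply: eq_big_seq => a; rewrite mem_divisors => am.
  rewrite big_distrr /= -[RHS]big_filter.
  have sE : perm_eq [seq c <- divisors m | (a `<=` c)%mset]
                    [seq (a `+` b)%mset | b <- divisors (m `\` a)%mset].
    apply: uniq_perm; first by rewrite filter_uniq ?fset_uniq.
      rewrite map_inj_in_uniq ?fset_uniq // => b c _ _ eqbc.
      by rewrite -(msetDKB a b) eqbc msetDKB.
    move=> c; rewrite mem_filter mem_divisors.
    apply/andP/mapP => [[ac cm]|[b bm ->]].
      by exists (c `\` a)%mset; rewrite ?msetBDKC // mem_divisors msetSB.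
    move: bm; rewrite mem_divisors => /msubsetP bm.
    move/msubsetP: am => am; split; apply/msubsetP => v.
      by rewrite msetE2 leq_addr.
    by rewrite msetE2 -leq_subRL ?am // -msetE2 bm.
  rewrite (perm_big _ sE) big_map; apply: eq_bigr => b _.
  by rewrite msetDKB msetBDA mulrA.
rewrite (exchange_big_dep xpredT) //=; apply: eq_big_seq => c.
rewrite mem_divisors => cm; rewrite big_distrl /= -[LHS]big_filter.
apply: perm_big; apply: uniq_perm.
- by rewrite filter_uniq ?fset_uniq.
- exact: fset_uniq.
move=> a; rewrite mem_filter !mem_divisors andb_idr // => ac.
exact: msubset_trans ac cm.
Qed.

Fact sone_neq0 : sone != 0.
Proof.
by apply/eqP => /(congr1 (fun f : series => f mset0)) /eqP; rewrite /sone eqxx oner_eq0.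
Qed.

HB.instance Definition _ := GRing.Zmodule_isComNzRing.Build series
  smulA smulC smul1 smulDl sone_neq0.

Fact sscaleA k l f : sscale k (sscale l f) = sscale (k * l) f.
Proof. by apply/funext => m; rewrite /sscale mulrA. Qed.
Fact sscale1 : left_id 1 sscale.
Proof. by move=> f; apply/funext => m; rewrite /sscale mul1r. Qed.
Fact sscaleDr : right_distributive sscale +%R.
Proof. by move=> k f g; apply/funext => m; exact: mulrDr. Qed.
Fact sscaleDl f : {morph sscale^~ f : k l / k + l}.
Proof. by move=> k l; apply/funext => m; exact: mulrDl. Qed.

HB.instance Definition _ := GRing.Zmodule_isLmodule.Build rat series
  sscaleA sscale1 sscaleDr sscaleDl.

Fact sscaleAl k f g : k *: (f * g) = k *: f * g.
Proof.
apply/funext => m; rewrite [LHS]big_distrr /=.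
by apply: eq_bigr => a _; exact: mulrA.
Qed.

HB.instance Definition _ := GRing.Lmodule_isLalgebra.Build rat series sscaleAl.
HB.instance Definition _ := GRing.Lalgebra_isComAlgebra.Build rat series.

End SeriesRing.

(* Substitution of v ^ r for every variable v, for r >= 1: then
   [mpow r a = m] forces a to divide m, and has at most one solution a. *)
Definition spow (r : nat) (f : series) : series :=
  fun m => \sum_(a <- divisors m | mpow r a == m) f a.

Definition Eplus (d : nat) : series :=
  fun m => if square_free m && (mdegree m == d) then 1 else 0.

Definition Eminus (d : nat) : series :=
  fun m => if square_free m && (mdegree m == d) then (-1) ^+ nvars m else 0.

Definition is_partition (s : seq nat) : bool := sorted geq s && (0%N \notin s).

(* The entry of index i (from 0) is the partition tau|^{i+1}; the partitions
   tau|^r with r > n of a type tau of n are necessarily empty. *)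
Record typ (n : nat) := Typ {
  typ_val :> n.-tuple (seq nat);
  typ_valP : all is_partition typ_val &&
             ((\sum_(i < n) i.+1 * sumn (tnth typ_val i))%N == n)
}.

HB.instance Definition _ n := [isSub for @typ_val n].
HB.instance Definition _ n := [Countable of typ n by <:].

Section TypFinite.
Variable n : nat.

Definition typ_code (t : typ n) : n.-tuple (n.-bseq 'I_n.+1) :=
  [tuple insub_bseq n [seq inord d | d <- tnth t i] | i < n].

Definition typ_decode (c : n.-tuple (n.-bseq 'I_n.+1)) : option (typ n) :=
  insub [tuple [seq val d | d <- (tnth c i : seq _)] | i < n].

Fact typ_codeK : pcancel typ_code typ_decode.
Proof.
move=> t; rewrite /typ_decode.
suff -> : [tuple [seq val d | d <- (tnth (typ_code t) i : seq _)] | i < n]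
          = typ_val t by rewrite valK.
apply: eq_from_tnth => i; rewrite !tnth_mktuple.
have /andP[/all_tnthP/(_ i)/andP[_ pos] /eqP sz] := typ_valP t.
have le_sum : (sumn (tnth t i) <= n)%N.
  rewrite -[leqRHS]sz (bigD1 i) //= mulSn -addnA; exact: leq_addr.
have {}pos : all (leq 1) (tnth t i).
  by apply/allP => d dt; rewrite lt0n; apply: contra pos => /eqP <-.
have le_size : (size (tnth t i) <= sumn (tnth t i))%N.
  by elim: (tnth t i) pos => //= d s IH /andP[d1 /IH le_s]; rewrite -add1n leq_add.
rewrite /insub_bseq insubdK; last first.
  by rewrite unfold_in /= size_map (leq_trans le_size).
rewrite -map_comp map_id_in // => d dt /=; rewrite inordK // ltnS.
by apply: leq_trans le_sum; rewrite sumnE (big_rem d dt) leq_addr.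
Qed.

HB.instance Definition _ : isFinite (typ n) := PCanIsFinite typ_codeK.

End TypFinite.

(* The block d^r is the pair (d, r). *)
Definition blocks n (t : typ n) : seq (nat * nat) :=
  [seq (d, (val i).+1) | i <- enum 'I_n, d <- tnth t i].

(* E^+_tau is [on_type Eplus tau] and E_tau is [on_type Eminus tau]. *)
Definition on_type (F : nat -> series) n (t : typ n) : series :=
  \prod_(b <- blocks t) spow b.2 (F b.1).

Section Tabloids.
Variable n : nat.
Implicit Types (s t : typ n).

(* (i, k, c) is the cell in column c of row k of the tensor factor i + 1, all
   three being counted from 0.  No diagram of a type of n has an index >= n. *)
Definition cell : finType := ('I_n * 'I_n * 'I_n)%type.

Definition diagram s : {set cell} :=
  [set x : cell | (x.2 < nth 0 (tnth s x.1.1) x.1.2)%N].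

Definition is_brick (B : {set cell}) : bool :=
  [exists r : 'I_n * 'I_n, exists a : 'I_n, exists b : 'I_n, (a <= b)%N &&
    (B == [set x : cell | (x.1 == r) && (a <= x.2 <= b)%N])].

(* A brick together with its mark: [true] for a doublebrick. *)
Definition piece : finType := ({set cell} * bool)%type.

Implicit Types (p q : piece) (T : {set piece}).

Definition is_piece p : bool :=
  is_brick p.1 && (p.2 ==> ~~ odd #|p.1|).

Definition is_decomposition s T : bool :=
  [&& [forall p in T, is_piece p],
      [forall p in T, forall q in T, (p != q) ==> [disjoint p.1 & q.1]] &
      \bigcup_(p in T) p.1 == diagram s].

Definition doublebricks_right T : bool :=
  [forall p in T, forall q in T, ~~ p.2 && q.2 ==>
    [forall x in p.1, forall y in q.1, (x.1 == y.1) ==> (x.2 < y.2)%N]].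

(* All cells of a piece lie in the same tensor factor. *)
Definition factor p : nat := if [pick x in p.1] is Some x then (x.1.1).+1 else 0.

Definition piece_block p : nat * nat :=
  if p.2 then (#|p.1|./2, (2 * factor p)%N) else (#|p.1|, factor p).

Definition has_content t T : bool :=
  perm_eq [seq piece_block p | p <- enum T] (blocks t).

Definition double_polybrick_tabloid s t T : bool :=
  [&& is_decomposition s T, doublebricks_right T & has_content t T].

Definition one_double_per_row T : bool :=
  [forall r, #|[set p in T | p.2 && [exists x in p.1, x.1 == r]]| <= 1]%N.

Definition PTdoub s t : {set {set piece}} :=
  [set T | double_polybrick_tabloid s t T && one_double_per_row T].

Definition ell1 T : nat := #|[set p in T | ~~ p.2]|.

End Tabloids.

(* Main.v *)
Require Import Defs.
From mathcomp Require Import all_boot all_order all_algebra.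
From mathcomp Require Import finmap multiset boolp zify lra.
Set Implicit Arguments.
Unset Strict Implicit.
Unset Printing Implicit Defensive.
Import Order.TTheory GRing.Theory Num.Theory.
Local Open Scope ring_scope.

(* From [E(t) E^+(t) = \prod_v (1 - v ^ 2 t ^ (2 deg v))] one gets
     E^+_d = [d even] E_{(d/2)^2} - \sum_(1 <= k <= d) E_k E^+_{d-k},
   which describes how a row of length d of a tabloid begins: either the whole
   row is one doublebrick, or its leftmost piece is a brick of length k.
   Removing the leftmost pieces one by one, the signed sum of the products of
   the E's over all the tabloids of shape sigma is the product of the E^+'s of
   the rows; collecting the tabloids by content gives the expansion.

   The E_tau are linearly independent by a triangularity argument: the type of
   a monomial is the multiset of the (degree, exponent) of its variables, and,
   for the weight \sum (r d ^ 2 + 1) over the blocks d^r, every monomial of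
   E_tau has at most the weight of tau, with equality only for type tau. *)

(* [prime.divisors] shadows the divisors of a monomial. *)
Local Notation divisors := Defs.divisors.
Implicit Types (a m : monom) (v : nat * nat) (d r : nat).

(** * Substitution of powers, and the convolution of E and E^+ *)

Lemma mulsE (f g : series) m :
  (f * g) m = \sum_(a <- divisors m) f a * g (m `\` a)%mset.
Proof. by []. Qed.

Lemma sumsE (I : Type) (s : seq I) (P : pred I) (F : I -> series) m :
  (\sum_(i <- s | P i) F i) m = \sum_(i <- s | P i) F i m.
Proof. exact: (big_morph (fun f : series => f m)). Qed.

Lemma mpow_inj r : (0 < r)%N -> injective (mpow r).
Proof.
move=> r0 a b /msetP eqab; apply/msetP => v.
by move: (eqab v); rewrite !mpowE; nia.
Qed.

Lemma spow_mpow r (f : series) a : (0 < r)%N -> spow r f (mpow r a) = f a.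
Proof.
move=> r0; rewrite /spow (eq_bigl (pred1 a)); last first.
  by move=> b; apply/eqP/eqP => [/(mpow_inj r0)->|->].
rewrite -big_filter filter_pred1_uniq ?big_seq1 ?fset_uniq //.
by rewrite mem_divisors; apply/msubsetP => v; rewrite mpowE leq_pmull.
Qed.

Lemma spow_nonpow r (f : series) m : (forall a, mpow r a <> m) -> spow r f m = 0.
Proof. by move=> Nm; rewrite /spow big1 // => a /eqP/Nm. Qed.

Lemma mpow_dvd r a b : (0 < r)%N -> (mpow r a `<=` mpow r b)%mset = (a `<=` b)%mset.
Proof.
move=> r0; apply/msubsetP/msubsetP => le v; move: (le v); rewrite !mpowE.
  by rewrite leq_pmul2l.
by rewrite leq_pmul2l.
Qed.

Lemma mpowB r a b : mpow r (a `\` b)%mset = (mpow r a `\` mpow r b)%mset.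
Proof. by apply/msetP => v; rewrite msetE2 !mpowE msetE2 mulnBr. Qed.

Lemma mpowD r a b : mpow r (a `+` b)%mset = (mpow r a `+` mpow r b)%mset.
Proof. by apply/msetP => v; rewrite msetE2 !mpowE msetE2 mulnDr. Qed.

(** The divisors of [mpow r c] that are r-th powers are the r-th powers of the divisors of [c], and
    passing to the cofactor respects this correspondence. *)
Lemma spowM r (f g : series) : (0 < r)%N -> spow r (f * g) = spow r f * spow r g.
Proof.
move=> r0; apply/funext => m; rewrite [RHS]mulsE.
have [[c ->]|Nm] := pselect (exists c, m = mpow r c); last first.
  (* If [a] and its cofactor in [m] were both r-th powers, so would be [m]. *)
  rewrite spow_nonpow; last by move=> a am; apply: Nm; exists a.
  rewrite big_seq big1 // => a; rewrite mem_divisors => am.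
  have [[b ab]|Na] := pselect (exists b, mpow r b = a); last first.
    by rewrite spow_nonpow ?mul0r // => b ba; apply: Na; exists b.
  rewrite [spow r g _]spow_nonpow ?mulr0 // => b' eb'; apply: Nm.
  by exists (b `+` b')%mset; rewrite mpowD eb' ab msetBDKC.
rewrite spow_mpow // mulsE.
transitivity (\sum_(a <- [fset mpow r b | b in divisors c]%fset)
    spow r f a * spow r g (mpow r c `\` a)%mset).
  rewrite [RHS]big_imfset /=; last by move=> ? ? _ _; exact: (mpow_inj r0).
  by apply: eq_bigr => a _; rewrite -mpowB !spow_mpow.
apply: big_fset_incl.
  apply/fsubsetP => _ /imfsetP[b /= + ->].
  by rewrite !mem_divisors mpow_dvd.
move=> a; rewrite mem_divisors => am Na; rewrite spow_nonpow ?mul0r // => b ba.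
case/negP: Na; apply/imfsetP; exists b => //=.
by rewrite mem_divisors -(mpow_dvd _ _ r0) ba.
Qed.

Lemma spow_sum r (I : Type) (s : seq I) (P : pred I) (F : I -> series) :
  spow r (\sum_(i <- s | P i) F i) = \sum_(i <- s | P i) spow r (F i).
Proof.
apply: (big_morph (spow r)) => [f g|]; apply/funext => m.
  by rewrite -[RHS]/(spow r f m + spow r g m) -big_split.
exact: big1.
Qed.

Lemma spowN r (f : series) : spow r (- f) = - spow r f.
Proof.
apply/funext => m; rewrite -[RHS]/(- (spow r f m)) /spow -sumrN.
exact: eq_bigr.
Qed.

Lemma mpow0 r : mpow r mset0 = mset0.
Proof. by apply/msetP => v; rewrite mpowE !mset0E muln0. Qed.

Lemma spow1 r : (0 < r)%N -> spow r 1 = 1.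
Proof.
move=> r0; apply/funext => m.
have [[c ->]|Nm] := pselect (exists c, m = mpow r c).
  rewrite spow_mpow // -[LHS]/((c == mset0)%:R) -[RHS]/((mpow r c == mset0)%:R).
  congr (_%:R); congr nat_of_bool; apply/eqP/eqP => [->|]; first exact: mpow0.
  by move=> c0; apply: (mpow_inj r0); rewrite mpow0.
rewrite spow_nonpow; last by move=> a am; apply: Nm; exists a.
rewrite -[RHS]/((m == mset0)%:R); case: eqP => // m0; case: Nm.
by exists mset0; rewrite mpow0.
Qed.

(** This gives a doublebrick in the factor [m] its multiplicity [2m]: the [spow 2] comes from the
    recurrence for E^+, the [spow m] from the factor. *)
Lemma spow_spow r s (f : series) : (0 < r)%N -> (0 < s)%N ->
  spow r (spow s f) = spow (s * r) f.
Proof.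
move=> r0 s0; apply/funext => m.
have mpowM a : mpow r (mpow s a) = mpow (s * r) a.
  by apply/msetP => v; rewrite !mpowE; lia.
have [[c ->]|Nm] := pselect (exists c, m = mpow r c); last first.
  rewrite !spow_nonpow // => a am; apply: Nm; last by exists a.
  by exists (mpow s a); rewrite mpowM.
rewrite spow_mpow //.
have [[b ->]|Nc] := pselect (exists b, c = mpow s b).
  by rewrite spow_mpow // mpowM spow_mpow // muln_gt0 s0.
rewrite !spow_nonpow // => a ac; apply: Nc; last by exists a.
by exists a; apply: (mpow_inj r0); rewrite mpowM.
Qed.

(** * Degrees, square-free monomials and the convolution identity *)

Lemma mdegree_sub m (D : {fset nat * nat}) : (finsupp m `<=` D)%fset ->
  mdegree m = (\sum_(v <- D) m v * v.1.+1)%N.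
Proof.
move=> mD; apply: big_fset_incl => // v _.
by rewrite memNfinsupp => /eqP->.
Qed.

Lemma mdegreeD (a b : monom) : mdegree (a `+` b)%mset = (mdegree a + mdegree b)%N.
Proof.
pose D := (finsupp a `|` finsupp b `|` finsupp (a `+` b)%mset)%fset.
rewrite !(@mdegree_sub _ D) -?big_split /=.
- by apply: eq_bigr => v _; rewrite msetE2 mulnDl.
- by rewrite /D -fsetUA fsubsetU ?fsubsetUl ?orbT // fsubsetUr.
- by rewrite /D -fsetUA fsubsetUl.
by rewrite /D fsubsetUr.
Qed.

Lemma mdegree_mpow r m : mdegree (mpow r m) = (r * mdegree m)%N.
Proof.
rewrite (@mdegree_sub _ (finsupp m)); last first.
  apply/fsubsetP => v; rewrite !mem_finsupp mpowE; apply: contra => /eqP->.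
  by rewrite muln0.
by rewrite /mdegree big_distrr; apply: eq_bigr => v _; rewrite mpowE -mulnA.
Qed.

Lemma square_freeP (m : monom) : reflect (forall v, (m v <= 1)%N) (square_free m).
Proof.
apply: (iffP forallP) => [sf v|sf v]; last exact: sf.
have [vm|] := boolP (v \in finsupp m); first exact: (sf [` vm]%fset).
by rewrite memNfinsupp => /eqP->.
Qed.

(* A sign-reversing involution as soon as [v] has exponent 1: it cancels the
   coefficients of \sum_k E_k E^+_{d-k} at the monomials that are not squares. *)
Definition toggle v (a : monom) : monom :=
  (if a v == 0%N then v +` a else a `\ v)%mset.

Lemma toggleE v a u : (a v <= 1)%N ->
  toggle v a u = if u == v then (1 - a v)%N else a u.
Proof.
rewrite /toggle; case: eqP => av.
  by move=> _; rewrite mset1DE av; case: eqP => [->|] //; rewrite av.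
by move=> ?; rewrite msetB1E; case: eqP => [->|] ; lia.
Qed.

Lemma nvars_toggle v a : square_free a ->
  (-1 : rat) ^+ nvars (toggle v a) = - (-1) ^+ nvars a.
Proof.
move/square_freeP => sfa; have sfv := sfa v.
have [av|av] := eqVneq (a v) 0%N.
  have -> : nvars (toggle v a) = (nvars a).+1; last by rewrite exprS mulN1r.
  rewrite /nvars -[RHS]add1n -[1%N](_ : nat_of_bool (v \notin finsupp a) = _); last first.
    by rewrite memNfinsupp av.
  rewrite -cardfsU1; congr #|` _|; apply/fsetP => u.
  by rewrite !inE !mem_finsupp toggleE //; case: (u =P v) => // ->; rewrite av.
have -> : nvars a = (nvars (toggle v a)).+1; last by rewrite exprS mulN1r opprK.
rewrite /nvars (cardfsD1 v (finsupp a)) mem_finsupp av add1n; congr _.+1.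
congr #|` _|; apply/fsetP => u.
rewrite !inE !mem_finsupp toggleE //; case: (u =P v) => //= _.
by move: sfv av; case: (a v) => [|[]].
Qed.

(** The variable [v] divides exactly one of [a] and its cofactor; moving it to the other one keeps
    both square-free and flips the sign. *)
Lemma sum_signs_toggle (m : monom) v : m v = 1%N ->
  \sum_(a <- divisors m | square_free a && square_free (m `\` a)%mset)
    (-1 : rat) ^+ nvars a = 0.
Proof.
move=> mv; set S := \sum_(_ <- _ | _) _.
pose A := [fset a in divisors m | square_free a && square_free (m `\` a)%mset]%fset.
have ES : S = \sum_(a <- A) (-1) ^+ nvars a.
  by rewrite /S big_fset_condE.
have memA a : (a \in A) = (a `<=` m)%mset && (square_free a && square_free (m `\` a)%mset).
  by rewrite !inE mem_divisors.
have leA a : a \in A -> (a v <= 1)%N.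
  by rewrite memA => /andP[_ /andP[/square_freeP sf _]].
have toggleA a : a \in A -> toggle v a \in A.
  move=> aA; have av1 := leA a aA; move: aA; rewrite !memA.
  case/andP=> /msubsetP am /andP[/square_freeP sfa /square_freeP sfma].
  apply/and3P; split.
  - apply/msubsetP => u; rewrite toggleE //; case: eqP => [->|_]; last exact: am.
    by rewrite mv; lia.
  - by apply/square_freeP => u; rewrite toggleE //; case: eqP => [|_]; [lia | exact: sfa].
  apply/square_freeP => u; move: (sfma u); rewrite !msetE2 toggleE //.
  by case: eqP => // ->; rewrite mv; lia.
have toggleK a : a \in A -> toggle v (toggle v a) = a.
  move=> aA; have av1 := leA a aA; apply/msetP => u.
  rewrite !toggleE ?eqxx //; last by lia.
  by case: eqP => // ->; lia.
(* Reindexing by the involution negates every term. *)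
have : S = - S.
  rewrite {1}ES; transitivity (\sum_(a <- [fset toggle v b | b in A]%fset) (-1 : rat) ^+ nvars a).
    apply: eq_fbigl => a; apply/idP/imfsetP => [aA|[b bA ->]]; last exact: toggleA.
    by exists (toggle v a); rewrite ?toggleK //=; exact: toggleA.
  rewrite big_imfset /=; last by move=> a b aA bA eab; rewrite -(toggleK a aA) eab toggleK.
  rewrite ES -sumrN; apply: eq_big_seq => a; rewrite memA => /and3P[_ sfa _].
  exact: nvars_toggle.
by lra.
Qed.

Lemma Eminus0 : Eminus 0 = 1.
Proof.
apply/funext => m; rewrite -[RHS]/((m == mset0)%:R) /Eminus.
case: (eqVneq m mset0) => [->|m0].
  have -> : mdegree mset0 = 0%N by rewrite /mdegree finsupp0 big_seq_fset0.
  rewrite /nvars finsupp0 cardfs0 eqxx andbT.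
  by case: square_freeP => // -[v]; rewrite mset0E.
case: eqP; rewrite ?andbF // => /eqP; rewrite /mdegree sum_nat_seq_eq0 => /allP deg0.
case/eqP: m0; apply/msetP => v; rewrite mset0E.
have [vm|] := boolP (v \in finsupp m); last by rewrite memNfinsupp => /eqP.
by move: (deg0 v vm) => /=; lia.
Qed.

Lemma Eplus0 : Eplus 0 = 1.
Proof.
rewrite -Eminus0; apply/funext => m; rewrite /Eplus /Eminus.
case: ifP => // /andP[_ /eqP]; rewrite /mdegree /nvars.
move/eqP; rewrite sum_nat_seq_eq0 => /allP deg0.
rewrite (_ : finsupp m = fset0) ?cardfs0 //.
apply/fsetP => v; rewrite inE; apply/negP => vm; move: (deg0 v vm) (vm).
by rewrite mem_finsupp /=; lia.
Qed.

(** The coefficient at [m] is a signed count of the factorizations of [m] into two square-free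
    monomials. It cancels if some exponent of [m] is 1; otherwise only [m = a ^ 2] with [a]
    square-free contributes. *)
Lemma Eminus_Eplus_conv d :
  \sum_(k < d.+1) Eminus k * Eplus (d - k) =
  if odd d then 0 else spow 2 (Eminus d./2).
Proof.
apply/funext => m; rewrite sumsE.
under eq_bigr => k _ do rewrite mulsE.
rewrite exchange_big /=.
pose Q a := square_free a && square_free (m `\` a)%mset.
(* Degrees add up, so a divisor [a] is selected by the single index [k = mdegree a] if [m] has
   degree [d], and by no index otherwise. *)
transitivity (if mdegree m == d then
  \sum_(a <- divisors m | Q a) (-1 : rat) ^+ nvars a else 0).
  transitivity (\sum_(a <- divisors m) if Q a && (mdegree m == d) then
      (-1 : rat) ^+ nvars a else 0); last first.
    by case: eqP => [_|_]; [under eq_bigr => a _ do rewrite andbT; rewrite -big_mkcond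
                   | rewrite big1 // => a _; rewrite andbF].
  apply: eq_big_seq => a; rewrite mem_divisors => am.
  have degm : mdegree m = (mdegree a + mdegree (m `\` a)%mset)%N.
    by rewrite -mdegreeD msetBDKC.
  rewrite /Eminus /Eplus /Q.
  have [sa|_] := boolP (square_free a); last by rewrite big1 // => k _; rewrite mul0r.
  have [sma|_] := boolP (square_free (m `\` a)%mset); last first.
    by rewrite big1 // => k _; rewrite mulr0.
  rewrite /=; case: eqP => [md|md].
    have ltad : (mdegree a < d.+1)%N by lia.
    rewrite (bigD1 (Ordinal ltad)) //= eqxx.
    rewrite (_ : _ == _)%N ?mulr1; last by apply/eqP; lia.
    rewrite big1 ?addr0 // => k; rewrite -val_eqE /= eq_sym => /negPf->.
    by rewrite mul0r.
  rewrite big1 // => k _; case: eqP; rewrite ?mul0r //; case: eqP; rewrite ?mulr0 //.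
  by move: (ltn_ord k); lia.
have [[v mv]|N1] := pselect (exists v, m v = 1%N).
  rewrite (sum_signs_toggle mv) if_same; case: ifP => // _.
  by rewrite spow_nonpow // => a /msetP/(_ v); rewrite mpowE mv; lia.
(* With no exponent equal to 1, an exponent of [m] is 0 or 2 whenever both factors are square-free,
   and it is shared equally between them. *)
have QE a : a \in divisors m -> Q a = (mpow 2 a == m) && square_free a.
  rewrite mem_divisors => /msubsetP am.
  apply/andP/andP => [[/square_freeP sa /square_freeP sma]|[/eqP <- /square_freeP sa]].
    split; last exact/square_freeP.
    apply/eqP/msetP => v; rewrite mpowE.
    have := sma v; rewrite msetE2; have := sa v; have := am v.
    have : m v <> 1%N by move=> mv; apply: N1; exists v.
    by lia.
  split; apply/square_freeP => v //; rewrite msetE2 mpowE.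
  by move: (sa v); lia.
transitivity (if mdegree m == d then
    \sum_(a <- divisors m | (mpow 2 a == m) && square_free a) (-1 : rat) ^+ nvars a else 0).
  by congr (if _ then _ else _); rewrite big_seq_cond [RHS]big_seq_cond;
    apply: eq_bigl => a; case: (boolP (a \in _)) => //= /QE.
(* A square has even degree, so nothing remains for odd [d]. *)
have [dodd|deven] := boolP (odd d).
  case: eqP => // md; rewrite big1 // => a /andP[/eqP am _].
  by move: md dodd; rewrite -am mdegree_mpow => <-; rewrite oddM.
rewrite /spow /Eminus; transitivity
  (\sum_(a <- divisors m | mpow 2 a == m) if square_free a && (mdegree m == d) then (-1 : rat) ^+ nvars a else 0).
  case: eqP => [_|_]; last by rewrite big1 // => a _; rewrite andbF.
  by rewrite big_mkcondr; apply: eq_bigr => a _; rewrite andbT.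
apply: eq_bigr => a /eqP <-; rewrite mdegree_mpow.
by congr (if _ && _ then _ else _); apply/eqP/eqP; lia.
Qed.

(** * Linear independence of the E_tau *)

(* Splitting a block d^r into i^r, j^r, ... (choosing a monomial with several
   variables in [E_d]) and merging i^r, i^s into i^(r+s) (multiplying powers of
   the same variable) both strictly decrease this weight. *)
Definition mweight (m : monom) : nat :=
  \sum_(v <- finsupp m) (m v * v.1.+1 ^ 2 + 1)%N.

Definition bweight (l : seq (nat * nat)) : nat :=
  \sum_(b <- l) (b.2 * b.1 ^ 2 + 1)%N.

Definition mtype (m : monom) : seq (nat * nat) :=
  [seq (v.1.+1, m v) | v <- finsupp m].

(** Arbitrary lists of blocks allow induction block by block, whereas removing a block from a type
    of [n] would change [n]. *)
Definition prodE (l : seq (nat * nat)) : series :=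
  \prod_(b <- l) spow b.2 (Eminus b.1).

Lemma finsuppD (a b : monom) :
  finsupp (a `+` b)%mset = (finsupp a `|` finsupp b)%fset.
Proof.
by apply/fsetP => v; rewrite !inE !mem_finsupp msetE2 addn_eq0 negb_and.
Qed.

(** Replacing the unit by the indicator of [m v != 0] makes the summand vanish off the support, so
    that several monomials can be compared over one index set. *)
Lemma mweight_sub m (D : {fset nat * nat}) : (finsupp m `<=` D)%fset ->
  mweight m = (\sum_(v <- D) (m v * v.1.+1 ^ 2 + (m v != 0)))%N.
Proof.
move=> mD; transitivity (\sum_(v <- finsupp m) (m v * v.1.+1 ^ 2 + (m v != 0)))%N.
  by apply: eq_big_seq => v; rewrite mem_finsupp => ->.
apply: big_fset_incl => // v _.
by rewrite memNfinsupp => /eqP->.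
Qed.

(** Exponents add up, but the unit of a common variable counts once on the left and twice on the
    right. The next lemma is the resulting equality case. *)
Lemma mweightD a b : (mweight (a `+` b)%mset <= mweight a + mweight b)%N.
Proof.
rewrite !(@mweight_sub _ (finsupp a `|` finsupp b)%fset) ?finsuppD //.
- by rewrite -big_split leq_sum // => v _ /=; rewrite msetE2; case: (a v); case: (b v); lia.
- exact: fsubsetUr.
exact: fsubsetUl.
Qed.

Lemma mweightD_disjoint a b :
  (mweight a + mweight b <= mweight (a `+` b)%mset)%N ->
  [disjoint finsupp a & finsupp b]%fset.
Proof.
rewrite !(@mweight_sub _ (finsupp a `|` finsupp b)%fset) ?finsuppD ?fsubsetUl ?fsubsetUr //.
move=> le; apply/fdisjointP => v va; apply/negP => vb; move: le; apply/negP.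
have vD : v \in (finsupp a `|` finsupp b)%fset by rewrite inE va.
rewrite -ltnNge -big_split /= [ltnLHS](big_fsetD1 v) //= [ltnRHS](big_fsetD1 v) //= -addSn leq_add //.
  by move: va vb; rewrite !mem_finsupp msetE2; case: (a v); case: (b v); lia.
by rewrite leq_sum // => u _ /=; rewrite msetE2; case: (a u); case: (b u); lia.
Qed.

Lemma mtypeD a b : [disjoint finsupp a & finsupp b]%fset ->
  perm_eq (mtype (a `+` b)%mset) (mtype a ++ mtype b).
Proof.
move=> dab.
have -> : mtype a ++ mtype b = [seq (v.1.+1, (a `+` b)%mset v) | v <- finsupp a ++ finsupp b].
  rewrite map_cat; congr (_ ++ _); apply/eq_in_map => v vm; rewrite msetE2.
    by move/fdisjointP: dab => /(_ v vm); rewrite memNfinsupp => /eqP->; rewrite addn0.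
  by move: dab; rewrite fdisjoint_sym => /fdisjointP/(_ v vm); rewrite memNfinsupp => /eqP->.
apply: perm_map; apply: uniq_perm; first exact: fset_uniq.
  rewrite cat_uniq !fset_uniq andbT /=; apply/hasPn => v vb.
  by move: dab; rewrite fdisjoint_sym => /fdisjointP/(_ v vb).
by move=> v; rewrite finsuppD mem_cat inE.
Qed.

Lemma mweight_mtype m l : perm_eq (mtype m) l -> mweight m = bweight l.
Proof. by move=> /(perm_big _) ml; rewrite /bweight -ml big_map. Qed.

(** Splitting off an entry [x] from a sum [x + Y] costs one more unit but loses the cross term
    [2 * r * x * Y], which is at least 2. The empty list gives [0 < 1], and a singleton gives
    equality. *)
Lemma sum_sqr_lt r (l : seq nat) : (0 < r)%N -> all (leq 1) l -> size l != 1%N ->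
  (\sum_(x <- l) (r * x ^ 2 + 1) < r * (\sum_(x <- l) x) ^ 2 + 1)%N.
Proof.
move=> r0; elim: l => [|x l IH] /=; first by rewrite !big_nil addn1.
case: l IH => [|y l] // IH /andP[x0 pos] _; rewrite !big_cons.
have : (\sum_(z <- y :: l) (r * z ^ 2 + 1) <= r * (\sum_(z <- y :: l) z) ^ 2 + 1)%N.
  case: l IH pos => [|z l] IH pos; first by rewrite !big_seq1.
  by rewrite ltnW // IH.
have : (0 < \sum_(z <- y :: l) z)%N.
  by case/andP: pos => y0 _; rewrite big_cons addn_gt0 y0.
rewrite !big_cons; set Y := (y + _)%N; set Z := (_ + _ + _)%N => Y0 leZ.
have : (0 < r * x * Y)%N by rewrite !muln_gt0 r0 x0.
by nia.
Qed.

Lemma finsupp_mpow r a : (0 < r)%N -> finsupp (mpow r a) = finsupp a.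
Proof.
by move=> r0; apply/fsetP => v; rewrite !mem_finsupp mpowE muln_eq0; case: r r0.
Qed.

Lemma sqfree_mdegree a : square_free a -> mdegree a = (\sum_(v <- finsupp a) v.1.+1)%N.
Proof.
move/square_freeP => sa; apply: eq_big_seq => v.
by rewrite mem_finsupp; move: (sa v); case: (a v) => [|[]] //; rewrite mul1n.
Qed.

Lemma mweight_mpow_sqfree r a : (0 < r)%N -> square_free a ->
  mweight (mpow r a) = (\sum_(v <- finsupp a) (r * v.1.+1 ^ 2 + 1))%N.
Proof.
move=> r0 /square_freeP sa; rewrite /mweight finsupp_mpow //; apply: eq_big_seq => v.
rewrite mem_finsupp mpowE; move: (sa v).
by case: (a v) => [|[]] //; rewrite muln1.
Qed.

(** A monomial of E_{d^r} is the r-th power of a square-free one whose variables have degrees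
    summing to [d]. By [sum_sqr_lt] the bound is attained only by a single variable, whose sign is
    -1. *)
Lemma mweight_spow_Eminus d r m : (0 < r)%N ->
  spow r (Eminus d) m != 0 ->
  (mweight m <= r * d ^ 2 + 1)%N /\
  (mweight m = (r * d ^ 2 + 1)%N ->
     mtype m = [:: (d, r)] /\ spow r (Eminus d) m = -1).
Proof.
move=> r0; have [[a ->]|Nm] := pselect (exists a, m = mpow r a); last first.
  by rewrite spow_nonpow ?eqxx // => a am; apply: Nm; exists a.
rewrite spow_mpow // /Eminus; case: ifP; rewrite ?eqxx // => /andP[sa /eqP da] _.
rewrite mweight_mpow_sqfree //; move: da; rewrite sqfree_mdegree // => da.
have [sz|] := boolP (size (finsupp a) == 1%N); last first.
  rewrite -(size_map (fun v => v.1.+1)) => /(sum_sqr_lt r0).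
  rewrite !big_map da all_map => lt.
  have {}lt := lt (introT allP (fun v _ => isT)).
  by split; [exact: ltnW | move=> e; move: lt; rewrite e ltnn].
have [v Ea] : exists v, finsupp a = [fset v]%fset.
  by apply/cardfs1P; exact: sz.
move: da; rewrite /mtype finsupp_mpow // Ea !big_seq_fset1 => <-; split=> // _.
rewrite /nvars Ea cardfs1; split => //.
have av : a v != 0%N by rewrite -mem_finsupp Ea in_fset1.
rewrite -fset_seq1 /= mpowE; move/square_freeP: sa => /(_ v); move: av.
by case: (a v) => [|[]] //; rewrite muln1.
Qed.

Lemma mtype_nil m : mtype m = [::] -> m = mset0.
Proof.
move=> m0; apply/msetP => v; rewrite mset0E; apply/eqP; rewrite -memNfinsupp.
by apply/negP => /(map_f (fun v => (v.1.+1, m v))); rewrite -/(mtype m) m0.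
Qed.

Lemma mtype_msetn k v : (0 < k)%N -> mtype (msetn k v) = [:: (v.1.+1, k)].
Proof. by move=> k0; rewrite /mtype finsupp_msetn k0 -fset_seq1 /= msetnxx. Qed.

Lemma prodE_nil m : prodE [::] m = (m == mset0)%:R.
Proof. by rewrite /prodE big_nil. Qed.

Lemma prodE_cons b l m : prodE (b :: l) m =
  \sum_(a <- divisors m) spow b.2 (Eminus b.1) a * prodE l (m `\` a)%mset.
Proof. by rewrite /prodE big_cons. Qed.

Lemma spow_Eminus_msetn v r : (0 < r)%N ->
  spow r (Eminus v.1.+1) (msetn r v) = -1.
Proof.
move=> r0.
have -> : msetn r v = mpow r (msetn 1 v).
  by apply/msetP => u; rewrite mpowE !msetnE; case: eqP; rewrite ?muln1 ?muln0.
rewrite spow_mpow // /Eminus /nvars /mdegree finsupp_msetn /= cardfs1 big_seq_fset1.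
rewrite msetnxx mul1n eqxx andbT; case: square_freeP => // -[u].
by rewrite msetnE; case: eqP.
Qed.

(** The sign claim is what makes the induction work: at maximal weight all terms of the product have
    the sign [(-1) ^+ size l], so they cannot cancel and one nonzero term suffices for the last
    claim. *)
Lemma prodE_leading (l : seq (nat * nat)) m : all (fun b => 0 < b.2)%N l ->
  [/\ prodE l m != 0 -> (mweight m <= bweight l)%N,
      mweight m = bweight l -> 0 <= (-1) ^+ size l * prodE l m,
      prodE l m != 0 -> mweight m = bweight l -> perm_eq (mtype m) l &
      perm_eq (mtype m) l -> 0 < (-1) ^+ size l * prodE l m].
Proof.
elim: l m => [|[d r] l IH] m /=.
  move=> _; rewrite prodE_nil mul1r /bweight big_nil.
  case: (m =P mset0) => [->|m0]; first by rewrite /mweight /mtype finsupp0 !big_seq_fset0.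
  by split; rewrite ?eqxx // => /perm_nilP/mtype_nil.
case/andP=> r0 lpos; pose B := spow r (Eminus d).
have bw : bweight ((d, r) :: l) = (r * d ^ 2 + 1 + bweight l)%N.
  by rewrite /bweight big_cons.
have term a : a \in divisors m -> B a * prodE l (m `\` a)%mset != 0 ->
    (mweight m <= bweight ((d, r) :: l))%N /\
    (mweight m = bweight ((d, r) :: l) -> perm_eq (mtype m) ((d, r) :: l) /\
      0 <= (-1) ^+ (size l).+1 * (B a * prodE l (m `\` a)%mset)).
  rewrite mem_divisors mulf_eq0 negb_or => am /andP[Ba0 Pa0].
  have [leB eqB] := mweight_spow_Eminus r0 Ba0.
  have [/(_ Pa0) leP signP /(_ Pa0) eqP _] := IH (m `\` a)%mset lpos.
  have := mweightD a (m `\` a)%mset; rewrite msetBDKC // bw => le.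
  split; first by lia.
  move=> eqw; have wa : mweight a = (r * d ^ 2 + 1)%N by lia.
  have wma : mweight (m `\` a)%mset = bweight l by lia.
  have [ta Ba1] := eqB wa; split; last first.
    by rewrite /B Ba1 exprS !mulN1r mulrNN signP.
  (* Maximal weight forces both factors to be maximal, so the weight is additive here and no
     variable is shared; the types then concatenate. *)
  have dis : [disjoint finsupp a & finsupp (m `\` a)%mset]%fset.
    by apply: mweightD_disjoint; rewrite msetBDKC // wa wma eqw.
  have := mtypeD dis; rewrite msetBDKC // ta => /perm_trans; apply.
  by rewrite perm_cons eqP.
have nz : prodE ((d, r) :: l) m != 0 ->
    exists2 a, a \in divisors m & B a * prodE l (m `\` a)%mset != 0.
  rewrite prodE_cons => sum0; apply/hasP; apply: contraNT sum0 => /hasPn all0.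
  by rewrite big_seq big1 // => a am; apply/eqP; move: (all0 a am); rewrite negbK.
have nonneg a : mweight m = bweight ((d, r) :: l) -> a \in divisors m ->
    0 <= (-1) ^+ (size l).+1 * (B a * prodE l (m `\` a)%mset).
  move=> eqw am; have [->|t0] := eqVneq (B a * prodE l (m `\` a)%mset) 0.
    by rewrite mulr0.
  by have [_ /(_ eqw)[]] := term a am t0.
split.
- by move/nz => [a am t0]; have [] := term a am t0.
- move=> eqw; rewrite prodE_cons big_distrr big_seq sumr_ge0 // => a am.
  exact: nonneg.
- by move/nz => [a am t0] eqw; have [_ /(_ eqw)[]] := term a am t0.
move=> tm; have eqw := mweight_mtype tm.
have : (d, r) \in mtype m by rewrite (perm_mem tm) mem_head.
case/mapP=> v; rewrite msuppE => vm [ed er].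
(* The full power of [v] in [m] is a monomial of E_{d^r}, and its cofactor has type [l]: this term
   is strictly positive, the others are nonnegative. *)
pose a := msetn r v.
have am : (a `<=` m)%mset.
  by apply/msubsetP => u; rewrite msetnE er; case: eqP => [->|].
have dis : [disjoint finsupp a & finsupp (m `\` a)%mset]%fset.
  apply/fdisjointP => u; rewrite finsupp_msetn r0 inE => /eqP->.
  by rewrite memNfinsupp msetE2 msetnxx er subnn.
have ta : perm_eq (mtype (m `\` a)%mset) l.
  rewrite -(perm_cons (d, r)) -(permPr tm) perm_sym.
  by have := mtypeD dis; rewrite msetBDKC // mtype_msetn // -ed.
have [_ _ _ /(_ ta) pos] := IH (m `\` a)%mset lpos.
rewrite prodE_cons big_distrr (big_rem a) ?mem_divisors //=.
apply: ltr_wpDr; last first.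
  by rewrite ed spow_Eminus_msetn // exprS !mulN1r mulrNN.
rewrite big_seq sumr_ge0 // => c /mem_rem cm; exact: nonneg.
Qed.

Lemma mtype_surj (l : seq (nat * nat)) : all (fun b => (0 < b.1) && (0 < b.2))%N l ->
  exists m, perm_eq (mtype m) l.
Proof.
move=> lpos.
(* Bounding the second indices by the length of the list keeps the index [size l] fresh for the next
   variable. *)
suff [m tm _] : exists2 m, perm_eq (mtype m) l &
    forall v, v \in finsupp m -> (v.2 < size l)%N by exists m.
elim: l lpos => [|[d r] l IH] /=.
  by exists mset0; rewrite /mtype finsupp0.
case/andP=> /andP[d0 r0] /IH[m tm ltm].
(* Indices start from 0, so the variable of degree [d] has first index [d.-1]. *)
pose v : nat * nat := (d.-1, size l).
have dis : [disjoint finsupp (msetn r v) & finsupp m]%fset.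
  apply/fdisjointP => u; rewrite finsupp_msetn r0 inE => /eqP->.
  by apply/negP => /ltm; rewrite ltnn.
exists (msetn r v `+` m)%mset.
  apply: perm_trans (mtypeD dis) _.
  by rewrite mtype_msetn //= prednK // perm_cons.
move=> u; rewrite finsuppD inE finsupp_msetn r0 inE => /orP[/eqP->//|/ltm].
exact: ltnW.
Qed.

(** * Types and their multisets of blocks *)

Lemma blocks_count n (t : typ n) d r :
  count_mem (d, r) (blocks t) =
  (\sum_(i < n | r == i.+1) count_mem d (tnth t i))%N.
Proof.
rewrite /blocks count_flatten -map_comp sumnE big_map big_enum /= [RHS]big_mkcond.
apply: eq_bigr => i _; rewrite /= count_map; case: eqP => [->|ri].
  by apply: eq_count => x; rewrite /= xpair_eqE eqxx andbT.
rewrite -(count_pred0 (tnth t i)); apply: eq_count => x.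
by rewrite /= xpair_eqE; case: (i.+1 =P r) => [/esym //|_]; rewrite andbF.
Qed.

Lemma typ_partition n (t : typ n) i : is_partition (tnth t i).
Proof. by have /andP[/all_tnthP] := typ_valP t. Qed.

Lemma blocks_gt0 n (t : typ n) :
  all (fun b => (0 < b.1) && (0 < b.2))%N (blocks t).
Proof.
apply/allP => _ /allpairsPdep[i [d [_ dt ->]]] /=; rewrite andbT lt0n.
by have /andP[_] := typ_partition t i; apply: contra => /eqP <-.
Qed.

(** A sorted list is determined by the multiplicities of its entries, and [blocks_count] reads these
    off the blocks. *)
Lemma blocks_inj n (t u : typ n) : perm_eq (blocks t) (blocks u) -> t = u.
Proof.
move=> /permP tu; apply: val_inj; apply: eq_from_tnth => i.
have /andP[st _] := typ_partition t i; have /andP[su _] := typ_partition u i.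
apply: (sorted_eq _ _ st su); [exact/rev_trans/leq_trans| |].
  by move=> x y; rewrite andbC; exact: anti_leq.
apply/allP => d _; move: (tu (pred1 (d, i.+1))).
have pE (j : 'I_n) : (i.+1 == j.+1) = (j == i) by rewrite eqSS eq_sym.
by rewrite !blocks_count !(eq_bigl _ _ pE) !big_pred1_eq /= => ->.
Qed.

Lemma blocks_sum n (t : typ n) : (\sum_(b <- blocks t) b.1 * b.2)%N = n.
Proof.
have /andP[_ /eqP tn] := typ_valP t; rewrite -[RHS]tn.
rewrite /blocks big_allpairs_dep /= big_enum /=; apply: eq_bigr => i _.
by rewrite sumnE big_distrr; apply: eq_bigr => d _; rewrite mulnC.
Qed.

Lemma blocks_surj n (l : seq (nat * nat)) :
  all (fun b => (0 < b.1) && (0 < b.2))%N l ->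
  (\sum_(b <- l) b.1 * b.2)%N = n -> exists t : typ n, perm_eq (blocks t) l.
Proof.
move=> lpos ln.
pose p i := sort geq [seq b.1 | b <- l & b.2 == i.+1].
(* The total [n] bounds every multiplicity, so each block finds its place among the [n] entries of
   the tuple. *)
have ltl b : b \in l -> (0 < b.2 <= n)%N.
  move=> bl; have /andP[b1 b2] := allP lpos b bl.
  rewrite b2 -ln (big_rem b) //= (leq_trans _ (leq_addr _ _)) //.
  exact: leq_pmull.
have part i : is_partition (p i).
  rewrite /is_partition sort_sorted; last by move=> x y; exact: leq_total.
  rewrite mem_sort; apply/mapP => -[b]; rewrite mem_filter => /andP[_ bl] b0.
  by have /andP[] := allP lpos b bl; rewrite -b0.
pose t : n.-tuple (seq nat) := [tuple p i | i < n].
have tE i : tnth t i = p i by rewrite tnth_mktuple.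
have sz : (\sum_(i < n) i.+1 * sumn (tnth t i))%N = n.
  rewrite -[RHS]ln.
  transitivity (\sum_(i < n) \sum_(b <- l) i.+1 * (if b.2 == i.+1 then b.1 else 0))%N.
    apply: eq_bigr => i _; rewrite tE /p (perm_sumn (permEl (perm_sort _ _))).
    by rewrite sumnE big_map big_filter big_mkcond big_distrr.
  rewrite exchange_big /=; apply: eq_big_seq => b bl.
  have /andP[b0 bn] := ltl b bl.
  have ltb : (b.2.-1 < n)%N by lia.
  rewrite (bigD1 (Ordinal ltb)) //= prednK // eqxx big1 ?addn0 1?mulnC //.
  move=> i; rewrite -val_eqE /= => ib; case: eqP => [bi|_]; last exact: muln0.
  by case/eqP: ib; rewrite bi.
have tP : all is_partition t && ((\sum_(i < n) i.+1 * sumn (tnth t i))%N == n).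
  rewrite sz eqxx andbT; apply/all_tnthP => i; rewrite tE; exact: part.
exists (Typ tP); apply/allP => -[d r] _ /=; apply/eqP.
rewrite blocks_count /=.
have [/andP[r0 rn]|rn] := boolP (0 < r <= n)%N; last first.
  rewrite big1 => [|i /eqP ri]; last by case/negP: rn; rewrite ri ltn_ord.
  apply/esym/count_memPn; apply: contra rn; exact: ltl.
have ltr : (r.-1 < n)%N by lia.
have rE (i : 'I_n) : (r == i.+1) = (i == Ordinal ltr).
  by rewrite -val_eqE /=; apply/eqP/eqP; lia.
rewrite (eq_bigl _ _ rE) big_pred1_eq.
rewrite tE /p /= prednK // (permP (permEl (perm_sort _ _))).
rewrite count_map count_filter; apply: eq_count => -[x y] /=.
by rewrite xpair_eqE.
Qed.

Lemma on_type_Eminus n (t : typ n) : on_type Eminus t = prodE (blocks t).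
Proof. by []. Qed.

(** Among the types with nonzero coefficient take [rho] of maximal weight, and a monomial [m] of
    type [rho]. An E_t containing [m] has at least the weight of [rho], hence the same weight by
    maximality, and then [t = rho]. *)
Lemma Eminus_free n (c : typ n -> rat) :
  \sum_rho c rho *: on_type Eminus rho = 0 -> forall rho, c rho = 0.
Proof.
move=> sum0 rho0; apply/eqP; apply/negPn/negP => c0.
case: (@arg_maxnP _ rho0 (fun t => c t != 0) (fun t => bweight (blocks t)) c0).
move=> rho cr maxr.
have pos t : all (fun b => 0 < b.2)%N (blocks (t : typ n)).
  by apply: sub_all (blocks_gt0 t) => b /andP[].
have [m tm] := mtype_surj (blocks_gt0 rho).
have [_ _ _ /(_ tm) lead] := prodE_leading m (pos rho).
have /eqP := congr1 (fun f : series => f m) sum0.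
rewrite sumsE (bigD1 rho) //= big1 => [|t tr].
  rewrite -[X in X + _ == _]/(c rho * prodE (blocks rho) m) addr0.
  rewrite -[X in _ == X]/(0 : rat) mulf_eq0 (negPf cr) => /eqP P0.
  by move: lead; rewrite P0 mulr0 ltxx.
rewrite -[LHS]/(c t * prodE (blocks t) m).
have [->|ct] := eqVneq (c t) 0; first by rewrite mul0r.
have [->|Pt] := eqVneq (prodE (blocks t) m) 0; first by rewrite mulr0.
have [/(_ Pt) le _ /(_ Pt) eqt _] := prodE_leading m (pos t).
case/eqP: tr; apply: blocks_inj; rewrite -(permPr tm) perm_sym; apply: eqt.
apply/eqP; rewrite eqn_leq le (mweight_mtype tm).
exact: maxr.
Qed.

(** * Tabloids with shortened rows *)

(** Half-open bounds make the length [b - a] and let the next piece of the row start at [b]. *)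
Definition row_seg n (r : 'I_n * 'I_n) (a b : nat) : {set cell n} :=
  [set x : cell n | (x.1 == r) && (a <= x.2 < b)%N].

Lemma is_brickP n (B : {set cell n}) :
  reflect (exists (r : 'I_n * 'I_n) (a b : nat), [/\ (a < b)%N, (b <= n)%N & B = row_seg r a b]) (is_brick B).
Proof.
apply: (iffP existsP) => [[r /existsP[a /existsP[b /andP[ab /eqP->]]]]|].
  by exists r, a, b.+1; split.
case=> r [a [b [ab bn ->]]]; exists r.
have an : (a < n)%N by lia.
have b'n : (b.-1 < n)%N by lia.
apply/existsP; exists (Ordinal an); apply/existsP; exists (Ordinal b'n) => /=.
apply/andP; split; first by lia.
apply/eqP/setP => x; rewrite !inE /=; congr (_ && _).
by case: b ab {bn b'n}.
Qed.

Lemma card_row_seg n (r : 'I_n * 'I_n) (a b : nat) : (b <= n)%N -> #|row_seg r a b| = (b - a)%N.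
Proof.
move=> bn; have -> : row_seg r a b = [set (r, c) | c : 'I_n & (a <= c < b)%N].
  apply/setP => -[r' c]; rewrite inE /=; apply/andP/imsetP => [[/eqP-> ab]|].
    by exists c; rewrite ?inE.
  by case=> c'; rewrite inE => ab [-> ->].
rewrite card_imset; last by move=> c c' [].
rewrite cardsE -sum1_card -[RHS]muln1 -sum_nat_const_nat.
rewrite (big_nat_widen _ _ n) // (big_nat_widenl _ 0) // big_mkord.
by apply: eq_bigl => c; rewrite andbC.
Qed.

Lemma row_seg_cell n (r : 'I_n * 'I_n) (a b c : nat) (cn : (c < n)%N) :
  ((r, Ordinal cn) \in row_seg r a b) = (a <= c < b)%N.
Proof. by rewrite inE eqxx. Qed.

Lemma row_seg_piece n (r : 'I_n * 'I_n) (a b : nat) mk : (a < b)%N -> (b <= n)%N ->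
  (mk ==> ~~ odd (b - a)) -> is_piece (row_seg r a b, mk).
Proof.
move=> ab bn mkP; rewrite /is_piece /= card_row_seg // mkP andbT.
by apply/is_brickP; exists r, a, b.
Qed.

Lemma piece_block_row_seg n (r : 'I_n * 'I_n) (a b : nat) mk : (a < b)%N -> (b <= n)%N ->
  piece_block (row_seg r a b, mk) =
  if mk then ((b - a)./2, (2 * r.1.+1)%N) else ((b - a)%N, r.1.+1).
Proof.
move=> ab bn; have an : (a < n)%N by lia.
have fE : factor (row_seg r a b, mk) = r.1.+1.
  rewrite /factor; case: pickP => [x|/(_ (r, Ordinal an))] /=.
    by rewrite inE => /andP[/eqP-> _].
  by rewrite row_seg_cell leqnn ab.
by rewrite /piece_block fE /= card_row_seg.
Qed.

(* Rows may start at a column [o r > 0], which allows removing pieces from the left. *)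
Definition skew_diagram n (o e : 'I_n * 'I_n -> nat) : {set cell n} :=
  [set x : cell n | (o x.1 <= x.2 < e x.1)%N].

Definition skew_tabloid n (o e : 'I_n * 'I_n -> nat) (T : {set piece n}) : bool :=
  [&& [forall p in T, is_piece p],
      [forall p in T, forall q in T, (p != q) ==> [disjoint p.1 & q.1]],
      \bigcup_(p in T) p.1 == skew_diagram o e,
      doublebricks_right T & one_double_per_row T].

(** Stated cell by cell, the conditions are easy to check after a piece is added or removed. *)
Definition skew_tabloid_spec n (o e : 'I_n * 'I_n -> nat) (T : {set piece n}) : Prop :=
  [/\ forall p, p \in T -> is_piece p,
      forall p q x, p \in T -> q \in T -> x \in p.1 -> x \in q.1 -> p = q,
      forall x, x \in skew_diagram o e <-> exists2 p, p \in T & x \in p.1,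
      forall p q x y, p \in T -> q \in T -> ~~ p.2 -> q.2 ->
        x \in p.1 -> y \in q.1 -> x.1 = y.1 -> (x.2 < y.2)%N &
      forall p q x y, p \in T -> q \in T -> p.2 -> q.2 ->
        x \in p.1 -> y \in q.1 -> x.1 = y.1 -> p = q].

Lemma skew_tabloidP n (o e : 'I_n * 'I_n -> nat) (T : {set piece n}) :
  reflect (skew_tabloid_spec o e T) (skew_tabloid o e T).
Proof.
apply: (iffP and5P) => -[pieces disj cover right one]; split.
- by move=> p pT; apply: (forall_inP pieces).
- move=> p q x pT qT xp xq; apply/eqP; apply/negPn/negP => pq.
  have /forall_inP/(_ q qT)/implyP/(_ pq) := forall_inP disj p pT.
  by move/disjointFr => /(_ x xp); rewrite xq.
- by move=> x; rewrite -(eqP cover); split=> /bigcupP.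
- move=> p q x y pT qT np dq xp yq /eqP xy.
  have /forall_inP/(_ q qT) := forall_inP right p pT.
  by rewrite np dq => /forall_inP/(_ x xp)/forall_inP/(_ y yq)/implyP; apply.
- move=> p q x y pT qT dp dq xp yq xy.
  have /card_le1_eqP h := forallP one x.1.
  by apply: h; rewrite !inE ?pT ?qT ?dp ?dq /=; apply/exists_inP;
    [exists y | exists x] => //; rewrite xy.
- by apply/forall_inP.
- apply/forall_inP => p pT; apply/forall_inP => q qT; apply/implyP => pq.
  rewrite -setI_eq0; apply/eqP/setP => x; rewrite !inE; apply/negP => /andP[xp xq].
  by case/eqP: pq; exact: disj xp xq.
- by apply/eqP/setP => x; apply/bigcupP/idP => /cover.
- apply/forall_inP => p pT; apply/forall_inP => q qT.
  apply/implyP => /andP[np dq]; apply/forall_inP => x xp; apply/forall_inP => y yq.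
  by apply/implyP => /eqP; apply: right xp yq.
apply/forallP => r; apply/card_le1_eqP => p q; rewrite !inE.
case/and3P=> pT dp /exists_inP[x xp /eqP xr] /and3P[qT dq /exists_inP[y yq /eqP yr]].
by apply: (one q p y x) => //; rewrite yr.
Qed.

Definition advance n (o : 'I_n * 'I_n -> nat) (r : 'I_n * 'I_n) (b : nat) :=
  fun s => if s == r then b else o s.

(** A leftmost doublebrick must reach the end of its row: neither a brick nor a second doublebrick
    may follow it. *)
Definition head_ok n (o e : 'I_n * 'I_n -> nat) (r : 'I_n * 'I_n) (b : nat) (mk : bool) :=
  (o r < b <= e r)%N && (mk ==> (b == e r) && ~~ odd (b - o r)).

Lemma skew_diagram_advance n (o e : 'I_n * 'I_n -> nat) (r : 'I_n * 'I_n) (b : nat) (x : cell n) :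
  (o r < b <= e r)%N ->
  (x \in skew_diagram (advance o r b) e) = (x \in skew_diagram o e) && (x \notin row_seg r (o r) b).
Proof.
rewrite /advance !inE; case: eqP => [->|_] /=; last by rewrite andbT.
by move=> ?; apply/idP/idP; lia.
Qed.

Lemma head_sub n (o e : 'I_n * 'I_n -> nat) (r : 'I_n * 'I_n) (b : nat) (x : cell n) :
  (o r < b <= e r)%N -> x \in row_seg r (o r) b -> x \in skew_diagram o e.
Proof. by rewrite !inE => ? /andP[/eqP-> ?]; lia. Qed.

(** The head is the piece covering the first cell of the row. *)
Lemma skew_tabloid_head n (o e : 'I_n * 'I_n -> nat) (T : {set piece n})
    (r : 'I_n * 'I_n) :
  (forall s, e s <= n)%N -> (o r < e r)%N -> skew_tabloid o e T ->
  exists (b : nat) (mk : bool), head_ok o e r b mk /\ (row_seg r (o r) b, mk) \in T.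
Proof.
move=> en oer /skew_tabloidP[pieces disj cover right one].
have ern := en r; have orn : (o r < n)%N by lia.
pose x0 : cell n := (r, Ordinal orn).
have [|[B mk] pT xp] := proj1 (cover x0); first by rewrite inE /= leqnn oer.
have := pieces _ pT; rewrite /is_piece /= => /andP[/is_brickP[r' [a [b [ab bn EB]]]] mkP].
have an : (a < n)%N by lia.
have b'n : (b.-1 < n)%N by lia.
(* Applied to the two end cells of the piece, this gives [a = o r] and [b <= e r]. *)
have in_skew c (cn : (c < n)%N) : (a <= c < b)%N -> (o r <= c < e r)%N.
  move=> acb; have rr' : r = r' by move: xp; rewrite /= EB inE => /andP[/eqP].
  have : (r, Ordinal cn) \in skew_diagram o e.
    by apply/cover; exists (B, mk) => //=; rewrite EB rr' row_seg_cell.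
  by rewrite inE.
move: xp; rewrite /= EB inE /= => /andP[/eqP rr' aob]; subst r'.
have ao : a = o r by have := in_skew a an; lia.
have be : (b <= e r)%N by have := in_skew b.-1 b'n; lia.
subst a; exists b, mk; rewrite -EB; split=> //; rewrite /head_ok be ab /=.
case: mk pT mkP => //= pT; rewrite EB card_row_seg // => ->; rewrite andbT.
case: eqP => // /eqP nbe.
(* If the doublebrick stopped before the end of the row, the piece covering the cell in column [b]
   would be a second doublebrick, or a brick to the right of a doublebrick. *)
have bltn : (b < n)%N by lia.
have [|q qT xq] := proj1 (cover (r, Ordinal bltn)); first by rewrite inE /=; lia.
have xB : x0 \in B by rewrite EB row_seg_cell leqnn.
have [dq|nq] := boolP q.2.
  have pq := one _ _ _ _ pT qT isT dq xB xq erefl.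
  by move: xq; rewrite -pq /= EB row_seg_cell ltnn andbF.
have := right _ _ _ _ qT pT nq isT xq xB erefl.
by rewrite /=; lia.
Qed.

Lemma skew_tabloid_head_uniq n (o e : 'I_n * 'I_n -> nat) (T : {set piece n})
    (r : 'I_n * 'I_n) (b b' : nat) (mk mk' : bool) :
  (forall s, e s <= n)%N -> skew_tabloid o e T ->
  head_ok o e r b mk -> head_ok o e r b' mk' ->
  (row_seg r (o r) b, mk) \in T -> (row_seg r (o r) b', mk') \in T ->
  b = b' /\ mk = mk'.
Proof.
move=> en /skew_tabloidP[_ disj _ _ _] /andP[/andP[ob be] _] /andP[/andP[ob' be'] _] pT qT.
have ern := en r; have orn : (o r < n)%N by lia.
have := disj _ _ (r, Ordinal orn) pT qT; rewrite !row_seg_cell leqnn ob ob'.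
case/(_ isT isT) => Eseg ->; split=> //; have := congr1 (fun A => #|pred_of_set A|) Eseg.
by rewrite !card_row_seg; lia.
Qed.

Lemma skew_tabloid_rem n (o e : 'I_n * 'I_n -> nat) (T : {set piece n})
    (r : 'I_n * 'I_n) (b : nat) (mk : bool) (p := (row_seg r (o r) b, mk) : piece n) :
  head_ok o e r b mk -> p \in T -> skew_tabloid o e T ->
  skew_tabloid (advance o r b) e (T :\ p).
Proof.
move=> /andP[obe _] pT /skew_tabloidP[pieces disj cover right one].
apply/skew_tabloidP; split.
- by move=> q /setD1P[_ /pieces].
- by move=> q q' x /setD1P[_ qT] /setD1P[_ q'T]; exact: disj.
- move=> x; rewrite skew_diagram_advance //; split=> [/andP[/cover[q qT xq] xp]|].
    exists q; rewrite // !inE qT andbT; apply: contra xp => /eqP qp.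
    by move: xq; rewrite qp.
  case=> q /setD1P[qp qT] xq; apply/andP; split; first by apply/cover; exists q.
  by apply/negP => xp; case/eqP: qp; apply: (disj q p x).
- by move=> q q' x y /setD1P[_ qT] /setD1P[_ q'T]; exact: right.
by move=> q q' x y /setD1P[_ qT] /setD1P[_ q'T]; exact: one.
Qed.

(** The new piece lies to the left of all others in its row, and if it is a doublebrick then
    [b = e r] leaves no other cell there; both conditions on doublebricks survive. *)
Lemma skew_tabloid_add n (o e : 'I_n * 'I_n -> nat) (T : {set piece n})
    (r : 'I_n * 'I_n) (b : nat) (mk : bool) (p := (row_seg r (o r) b, mk) : piece n) :
  (forall s, e s <= n)%N -> head_ok o e r b mk ->
  skew_tabloid (advance o r b) e T ->
  p \notin T /\ skew_tabloid o e (p |: T).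
Proof.
move=> en /andP[obe mkP] /skew_tabloidP[pieces disj cover right one].
have ern := en r; have orn : (o r < n)%N by lia.
have Tp q x : q \in T -> x \in q.1 -> x \notin p.1.
  move=> qT xq; have : x \in skew_diagram (advance o r b) e by apply/cover; exists q.
  by rewrite skew_diagram_advance // => /andP[].
have Tb q x : q \in T -> x \in q.1 -> x.1 = r -> (b <= x.2 < e r)%N.
  move=> qT xq xr; have : x \in skew_diagram (advance o r b) e by apply/cover; exists q.
  by rewrite inE /advance xr eqxx.
have pE x : x \in p.1 -> x.1 = r /\ (x.2 < b)%N.
  by rewrite inE => /andP[/eqP-> /andP[]].
have pd : mk -> b = e r by move=> mk1; move: mkP; rewrite mk1 => /andP[/eqP].
split.
  apply/negP => pT; have := Tp p (r, Ordinal orn) pT.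
  by rewrite row_seg_cell leqnn; case/andP: obe => -> _ /(_ isT).
apply/skew_tabloidP; split.
- move=> q /setU1P[->|/pieces//]; apply: row_seg_piece; lia.
- move=> q q' x /setU1P[->|qT] /setU1P[->|q'T] // xq xq'.
  + by have := Tp q' x q'T xq'; rewrite xq.
  + by have := Tp q x qT xq; rewrite xq'.
  exact: disj xq xq'.
- move=> x; split=> [xo|[q /setU1P[->|qT] xq]]; last 2 first.
  + exact: head_sub xq.
  + have : x \in skew_diagram (advance o r b) e by apply/cover; exists q.
    by rewrite skew_diagram_advance // => /andP[].
  have [xp|xp] := boolP (x \in p.1); first by exists p; rewrite // setU11.
  have /cover[q qT xq] : x \in skew_diagram (advance o r b) e by rewrite skew_diagram_advance // xo xp.
  by exists q => //; rewrite setU1r.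
- move=> q q' x y /setU1P[->|qT] /setU1P[->|q'T] nq dq' xq yq' xy.
  + by case/negP: nq.
  + have [xr xb] := pE x xq; have := Tb q' y q'T yq'; rewrite -xy xr => /(_ erefl).
    by lia.
  + have [yr yb] := pE y yq'; have := Tb q x qT xq; rewrite xy yr (pd dq') => /(_ erefl).
    by lia.
  exact: right xq yq' xy.
move=> q q' x y /setU1P[->|qT] /setU1P[->|q'T] // dq dq' xq yq' xy.
- have [xr xb] := pE x xq; have := Tb q' y q'T yq'; rewrite -xy xr (pd dq) => /(_ erefl).
  by lia.
- have [yr yb] := pE y yq'; have := Tb q x qT xq; rewrite xy yr (pd dq') => /(_ erefl).
  by lia.
exact: one xq yq' xy.
Qed.

(** * The signed sum over all tabloids of a shape *)

Lemma Eplus_rec d : (0 < d)%N ->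
  Eplus d = (if odd d then 0 else spow 2 (Eminus d./2)) -
    \sum_(k < d) Eminus k.+1 * Eplus (d - k.+1).
Proof.
(* The term [k = 0] of the convolution is E^+_d itself. *)
move=> d0; rewrite -Eminus_Eplus_conv big_ord_recl /= Eminus0 mul1r subn0.
by rewrite addrK.
Qed.

Definition piece_weight n (p : piece n) : series :=
  (-1) ^+ (~~ p.2) * spow (piece_block p).2 (Eminus (piece_block p).1).

Definition tabloid_weight n (T : {set piece n}) : series :=
  \prod_(p in T) piece_weight p.

Lemma skew_tabloid_sum_head n (o e : 'I_n * 'I_n -> nat) (r : 'I_n * 'I_n) :
  (forall s, e s <= n)%N -> (o r < e r)%N ->
  \sum_(T | skew_tabloid o e T) tabloid_weight T =
  \sum_(h : 'I_n.+1 * bool | head_ok o e r h.1 h.2)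
    piece_weight (row_seg r (o r) h.1, h.2) *
    \sum_(T | skew_tabloid (advance o r h.1) e T) tabloid_weight T.
Proof.
move=> en oer; pose hd (h : 'I_n.+1 * bool) : piece n := (row_seg r (o r) h.1, h.2).
(* The inserted inner sum has exactly one term, the head of row [r] in [T]. *)
transitivity (\sum_(T | skew_tabloid o e T)
    \sum_(h : 'I_n.+1 * bool | head_ok o e r h.1 h.2 && (hd h \in T)) tabloid_weight T).
  apply: eq_bigr => T tabT.
  have [b [mk [ok inT]]] := skew_tabloid_head en oer tabT.
  have bn : (b < n.+1)%N.
    by have := en r; have /andP[/andP[_ be] _] := ok; lia.
  rewrite (big_pred1 (Ordinal bn, mk)) // => -[b' mk'] /=; apply/andP/eqP.
    case=> ok' inT'; have [eb ->] := skew_tabloid_head_uniq en tabT ok' ok inT' inT.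
    by congr (_, _); apply: val_inj.
  by case=> -> ->.
rewrite (exchange_big_dep (fun h : 'I_n.+1 * bool => head_ok o e r h.1 h.2)) /=; last first.
  by move=> T h _ /andP[].
apply: eq_bigr => h ok; rewrite big_distrr /=.
rewrite (eq_bigl (fun T => skew_tabloid o e T && (hd h \in T))); last first.
  by move=> T; rewrite ok.
(* Adding the head is a bijection from the tabloids of the shortened shape, with removal as its
   inverse. *)
rewrite (reindex_onto (fun T => hd h |: T) (fun T => T :\ hd h)) /=; last first.
  by move=> T /andP[_ hT]; rewrite setD1K.
apply: eq_big => [T|T].
  rewrite setU11 andbT; apply/andP/idP => [[tabT /eqP <-]|tabT].
    by apply: skew_tabloid_rem => //; rewrite setU11.
  by have [hT tabhT] := skew_tabloid_add en ok tabT; rewrite setU1K ?tabhT.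
case/andP=> _ /eqP <-; rewrite setD1K ?setU11 //.
by rewrite /tabloid_weight (big_setD1 (hd h)) ?setU11.
Qed.

Lemma piece_weight_seg n (r : 'I_n * 'I_n) (a b : nat) mk :
  (a < b)%N -> (b <= n)%N ->
  piece_weight (row_seg r a b, mk) =
  spow r.1.+1 (if mk then spow 2 (Eminus (b - a)./2) else - Eminus (b - a)).
Proof.
move=> ab bn; rewrite /piece_weight piece_block_row_seg //.
case: mk => /=; first by rewrite expr0 mul1r spow_spow.
by rewrite expr1 mulN1r spowN.
Qed.

(** This is [Eplus_rec] read as a sum over heads: the doublebrick gives the squared term, and a
    brick of length [k] gives the product for [k]. *)
Lemma head_weights n (o e : 'I_n * 'I_n -> nat) (r : 'I_n * 'I_n) :
  (e r <= n)%N -> (o r < e r)%N ->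
  \sum_(h : 'I_n.+1 * bool | head_ok o e r h.1 h.2)
    piece_weight (row_seg r (o r) h.1, h.2) * spow r.1.+1 (Eplus (e r - h.1)) =
  spow r.1.+1 (Eplus (e r - o r)).
Proof.
move=> ern oer; set d := (e r - o r)%N.
rewrite Eplus_rec ?subn_gt0 //.
pose V (b : nat) mk : series :=
  (if mk then spow 2 (Eminus (b - o r)./2) else - Eminus (b - o r)) * Eplus (e r - b).
transitivity (spow r.1.+1 (\sum_(b < n.+1) \sum_(mk : bool)
   if head_ok o e r b mk then V b mk else 0)).
  rewrite pair_bigA -big_mkcond /= spow_sum; apply: eq_bigr => -[b mk] /= ok.
  have /andP[/andP[ob be] _] := ok.
  by rewrite piece_weight_seg -?spowM //; lia.
congr spow; under eq_bigr => b _ do rewrite big_bool.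
rewrite big_split /=; congr (_ + _).
  (* Only [b = e r] is allowed for a doublebrick, and then E^+_0 = 1 remains for the row. *)
  have eb : (e r < n.+1)%N by lia.
  rewrite (bigD1 (Ordinal eb)) //= big1 ?addr0 => [|b]; last first.
    rewrite -val_eqE /head_ok /= => /negPf ->; by rewrite andbF.
  rewrite /head_ok oer leqnn eqxx /= /V subnn Eplus0 mulr1 -/d.
  by case: odd.
rewrite -big_mkcond /= -sumrN.
transitivity (\sum_((o r).+1 <= b < (e r).+1) V b false).
  rewrite (big_nat_widen _ _ n.+1) // (big_nat_widenl _ 0) // big_mkord.
  by apply: eq_bigl => b; rewrite /head_ok andbT andbC.
(* Here [b = o r + k + 1], the end of a brick of length [k + 1]. *)
rewrite -[(o r).+1]add0n big_addn subSS -/d big_mkord; apply: eq_bigr => k _.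
rewrite /V mulNr; congr (- (Eminus _ * Eplus _)).
  by rewrite addnS subSn ?addnK ?leq_addl.
by rewrite /d; lia.
Qed.

(** By induction on the number of cells: removing the head of a nonempty row changes only the factor
    of that row, and [head_weights] sums these changes up. *)
Lemma skew_tabloid_sum n (o e : 'I_n * 'I_n -> nat) :
  (forall s, e s <= n)%N -> (forall s, o s <= e s)%N ->
  \sum_(T | skew_tabloid o e T) tabloid_weight T =
  \prod_(s : 'I_n * 'I_n) spow s.1.+1 (Eplus (e s - o s)).
Proof.
move=> en; move: {2}(\sum_s (e s - o s))%N.+1 (ltnSn (\sum_s (e s - o s))%N) => N.
elim: N o => // N IH o leN oe.
have [/existsP[r oer]|/existsPn full] := boolP [exists r, o r < e r]%N; last first.
  have eo s : e s = o s by have := oe s; have := full s; lia.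
  (* When all rows are empty, the empty tabloid is the only one. *)
  rewrite (big_pred1 set0) => [|T]; last first.
    apply/skew_tabloidP/eqP => [[pieces _ cover _ _]|->].
      apply/setP => p; rewrite inE; apply/negP => pT.
      have /andP[/is_brickP[r [a [b [ab bn pE]]]] _] := pieces p pT.
      have an : (a < n)%N by lia.
      have : (r, Ordinal an) \in skew_diagram o e.
        by apply/cover; exists p; rewrite // pE row_seg_cell leqnn.
      by rewrite inE eo; lia.
    split=> [p|p q x|x|p q x y|p q x y]; rewrite ?inE //.
    by split=> [|[p]]; rewrite ?inE // eo; lia.
  rewrite /tabloid_weight big_set0 big1 // => s _.
  by rewrite eo subnn Eplus0 spow1.
rewrite (skew_tabloid_sum_head en oer) (bigD1 r) //= -(head_weights (en r) oer).
rewrite big_distrl /=; apply: eq_bigr => h /andP[/andP[oh he] _].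
rewrite IH.
- rewrite (bigD1 r) //= {1}/advance eqxx mulrA; congr (_ * _).
  by apply: eq_bigr => s /negPf sr; rewrite /advance sr.
- rewrite -ltnS; apply: leq_trans leN; rewrite ltnS (bigD1 r) //= [ltnRHS](bigD1 r) //=.
  rewrite -addSn leq_add // {1}/advance ?eqxx; first by lia.
  by rewrite leq_sum // => s /negPf sr; rewrite /advance sr.
by move=> s; rewrite /advance; case: eqP => [->|].
Qed.

(** * Expansion of E^+_sigma *)

Definition row_len n (t : typ n) (s : 'I_n * 'I_n) : nat := nth 0 (tnth t s.1) s.2.

Lemma part_le n (t : typ n) i x : x \in tnth t i -> (x <= n)%N.
Proof.
move=> xt; have xb : (x, i.+1) \in blocks t.
  by apply/allpairsPdep; exists i, x; rewrite mem_enum.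
rewrite -[leqRHS](blocks_sum t) (big_rem _ xb) /=.
by rewrite (leq_trans _ (leq_addr _ _)) // leq_pmulr.
Qed.

Lemma row_len_le n (t : typ n) s : (row_len t s <= n)%N.
Proof.
have [lt|ge] := ltnP s.2 (size (tnth t s.1)); last by rewrite /row_len nth_default.
exact/part_le/mem_nth.
Qed.

Lemma size_part_le n (t : typ n) i : (size (tnth t i) <= n)%N.
Proof.
have /andP[_ /eqP tn] := typ_valP t; rewrite -[leqRHS]tn (bigD1 i) //=.
rewrite (leq_trans _ (leq_addr _ _)) // mulSn (leq_trans _ (leq_addr _ _)) //.
have /andP[_ pos] := typ_partition t i.
rewrite -sum1_size sumnE big_seq [leqRHS]big_seq leq_sum // => x xt.
by rewrite lt0n; apply: contra pos => /eqP <-.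
Qed.

(** Rows beyond the last part have length 0 by the default of [nth]; they contribute neutral
    elements, so every factor may be given [n] rows. *)
Lemma big_rows (R : Type) (idx : R) (op : Monoid.com_law idx) n (t : typ n)
    (i : 'I_n) (F : nat -> R) : F 0%N = idx ->
  \big[op/idx]_(x <- tnth t i) F x = \big[op/idx]_(k < n) F (row_len t (i, k)).
Proof.
move=> F0; rewrite (big_nth 0%N) (big_nat_widen _ _ n) ?size_part_le // big_mkord.
rewrite big_mkcond; apply: eq_bigr => k _; case: ltnP => // ge.
by rewrite /row_len nth_default.
Qed.

Lemma on_type_Eplus n (t : typ n) :
  on_type Eplus t = \prod_(s : 'I_n * 'I_n) spow s.1.+1 (Eplus (row_len t s)).
Proof.
rewrite /on_type /blocks big_allpairs_dep big_enum /=.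
rewrite -(pair_bigA _ (fun i k : 'I_n => spow i.+1 (Eplus (row_len t (i, k))))) /=.
apply: eq_bigr => i _.
by apply: (@big_rows _ _ _ _ _ _ (fun d => spow i.+1 (Eplus d))); rewrite Eplus0 spow1.
Qed.

Definition tabloids n (t : typ n) : pred {set piece n} :=
  skew_tabloid (fun=> 0%N) (row_len t).

Lemma PTdoubE n (s t : typ n) T :
  (T \in PTdoub s t) = tabloids s T && has_content t T.
Proof.
rewrite inE /double_polybrick_tabloid /is_decomposition /tabloids /skew_tabloid.
have -> : skew_diagram (fun=> 0%N) (row_len s) = diagram s.
  by apply/setP => x; rewrite !inE.
by rewrite -!andbA [has_content _ _ && _]andbC.
Qed.

Lemma tabloid_weightE n (T : {set piece n}) :
  tabloid_weight T = (-1) ^+ ell1 T *: prodE [seq piece_block p | p <- enum T].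
Proof.
rewrite /tabloid_weight /piece_weight big_split /= /prodE big_map big_enum /=.
have -> : ell1 T = (\sum_(p in T) ~~ p.2)%N.
  by rewrite /ell1 cardsE -sum1_card big_mkcondr; apply: eq_bigr => p _; case: p.2.
by rewrite prodrXr -[X in X * _]signr_odd mulr_sign -scaler_sign signr_odd.
Qed.

(** By [blocks_surj] it suffices that the blocks have total degree [n]. This follows by double
    counting cells, each weighted by the number of its tensor factor; a doublebrick of length [2b]
    in factor [m] contributes [b * 2m]. *)
Lemma tabloid_content n (s : typ n) (T : {set piece n}) : tabloids s T ->
  exists t : typ n, has_content t T.
Proof.
move=> /skew_tabloidP[pieces disj cover _ _].
have [||t tP] := @blocks_surj n [seq piece_block p | p <- enum T].
- apply/allP => _ /mapP[p + ->]; rewrite mem_enum => /pieces.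
  case: p => B mk /andP[/is_brickP[r [a [b [ab bn /= ->]]]] mkP].
  move: mkP; rewrite piece_block_row_seg // card_row_seg //.
  by case: mk => /=; lia.
- rewrite big_map big_enum /=.
  transitivity (\sum_(p in T) \sum_(x in p.1) x.1.1.+1)%N.
    apply: eq_bigr => -[B mk] /pieces /andP[/is_brickP[r [a [b [ab bn /= ->]]]] mkP].
    rewrite (eq_bigr (fun=> r.1.+1)); last by move=> x; rewrite inE => /andP[/eqP->].
    rewrite sum_nat_const; move: mkP; rewrite piece_block_row_seg // card_row_seg //.
    by case: mk => //= /even_halfK {2}<-; rewrite -muln2 mulnA.
  (* Each cell of the diagram lies in exactly one piece. *)
  rewrite (exchange_big_dep (fun x : cell n => x \in skew_diagram (fun=> 0%N) (row_len s))) /=;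
    last by move=> p x pT xp; apply/cover; exists p.
  transitivity (\sum_(x in skew_diagram (fun=> 0%N) (row_len s)) x.1.1.+1)%N.
    apply: eq_bigr => x /cover[p pT xp]; rewrite (big_pred1 p) // => q.
    by apply/andP/eqP => [[qT xq]|->//]; apply: disj xq xp.
  rewrite -[RHS](blocks_sum s) /blocks big_allpairs_dep big_enum /=.
  transitivity (\sum_(r : 'I_n * 'I_n) r.1.+1 * row_len s r)%N.
    transitivity (\sum_(r : 'I_n * 'I_n) \sum_(c < n | c < row_len s r) r.1.+1)%N.
      rewrite pair_big_dep /=; apply: eq_bigl => x; by rewrite inE.
    apply: eq_bigr => r _; transitivity (\sum_(0 <= c < row_len s r) r.1.+1)%N.
      by rewrite (big_nat_widen _ _ n) ?row_len_le // big_mkord.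
    by rewrite sum_nat_const_nat subn0 mulnC.
  rewrite -(pair_bigA _ (fun i k : 'I_n => i.+1 * row_len s (i, k))%N) /=.
  apply: eq_bigr => i _; rewrite -(@big_rows _ _ _ _ _ _ (fun d => i.+1 * d)%N) ?muln0 //.
  by apply: eq_bigr => d _; rewrite mulnC.
by exists t; rewrite /has_content perm_sym.
Qed.

Lemma on_type_Eplus_expansion n (s : typ n) :
  on_type Eplus s =
  \sum_t (\sum_(T in PTdoub s t) (-1) ^+ ell1 T) *: on_type Eminus t.
Proof.
transitivity (\sum_(T | tabloids s T) tabloid_weight T).
  rewrite skew_tabloid_sum // => [|r]; last exact: row_len_le.
  by rewrite on_type_Eplus; apply: eq_bigr => r _; rewrite subn0.
(* The inner sum has one term: a content exists by [tabloid_content] and is unique by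
   [blocks_inj]. *)
transitivity (\sum_(T | tabloids s T) \sum_(t | has_content t T)
    (-1) ^+ ell1 T *: on_type Eminus t).
  apply: eq_bigr => T /tabloid_content[t tT].
  rewrite (big_pred1 t) => [|u]; last first.
    apply/idP/eqP => [uT|->//]; apply: blocks_inj.
    by rewrite -(permPl uT).
  by rewrite tabloid_weightE on_type_Eminus /prodE (perm_big _ tT).
rewrite (exchange_big_dep xpredT) //=; apply: eq_bigr => t _.
rewrite scaler_suml; apply: eq_bigl => T; by rewrite PTdoubE.
Qed.

(** Existence and uniqueness of the expansion are part of the statement, so that the coefficient is
    well defined without assuming the basis property. *)
Theorem theorem43 (n : nat) (sigma tau : typ n) :
  (exists! c : {ffun typ n -> rat},
     on_type Eplus sigma = \sum_rho c rho *: on_type Eminus rho) /\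
  (forall c : {ffun typ n -> rat},
     on_type Eplus sigma = \sum_rho c rho *: on_type Eminus rho ->
     c tau = \sum_(T in PTdoub sigma tau) (-1) ^+ ell1 T).
Proof.
pose c0 : {ffun typ n -> rat} :=
  [ffun t => \sum_(T in PTdoub sigma t) (-1) ^+ ell1 T].
have c0P : on_type Eplus sigma = \sum_rho c0 rho *: on_type Eminus rho.
  by rewrite on_type_Eplus_expansion; apply: eq_bigr => t _; rewrite ffunE.
have uniq (c : {ffun typ n -> rat}) :
    on_type Eplus sigma = \sum_rho c rho *: on_type Eminus rho -> c0 = c.
  move=> cP; apply/ffunP => t; apply/eqP; rewrite -subr_eq0; apply/eqP.
  apply: (@Eminus_free _ (fun t => c0 t - c t)).
  under eq_bigr => u _ do rewrite scalerBl.
  by rewrite sumrB -c0P -cP subrr.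
split; first by exists c0.
by move=> c /uniq <-; rewrite ffunE.
Qed.
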